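(* Let $H$ be the honeycomb graph with white vertices $w_{x,y}=(x-\tfrac14,y-\tfrac14)$ and black vertices $b_{x,y}=(x+\tfrac14,y+\tfrac14)$, $(x,y)\in\mathbb Z^2$, and straight edges $b_{x,y}w_{x,y}$, $b_{x,y}w_{x+1,y}$, $b_{x,y}w_{x,y+1}$. Let $A,B$ be real $2\times2$ invertible matrices and take the connection $\phi_{b_{x,y}w_{x,y}}=I$, $\phi_{b_{x,y}w_{x+1,y}}=A$, $\phi_{b_{x,y}w_{x,y+1}}=B$. Take cilia as follows: at $w_{x,y}$ the cilium is the wedge containing the upward direction $(0,1)$ (between the edges to $b_{x,y}$ and to $b_{x-1,y}$); at $b_{x,y}$ the cilium is the wedge containing the direction $(-1,0)$ (between the edges to $w_{x,y}$ and to $w_{x,y+1}$). Suppose that among the three matrices $A$, $B$, $AB^{-1}$, either exactly two have both eigenvalues real and positive and the third has both eigenvalues real and negative, or all three have both eigenvalues real and negative. Then for every finite subgraph $\mathcal H$ of $H$ with equally many black and white vertices, equipped with the restricted connection and the induced cilia (at each vertex, the wedge of $\mathcal H$ containing the same direction), every $2$-multiweb $m\in\Omega_{\mathbf 2}(\mathcal H)$ (multiplicity $n_v=2$ at all vertices) has $\mathrm{Tr}_\Phi(m)>0$.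
   Context: An $\mathbf n$-multiweb on a bipartite graph with multiplicities $n_v$ is a function $m:E\to\mathbb Z_{\ge0}$ with $\sum_{u\sim v}m_{uv}=n_v$ for every vertex $v$. The connection matrix $\phi_{bw}$ is viewed as a linear map $\mathbb R^{2}\to\mathbb R^{2}$ from the black to the white endpoint. The cilium at $v$ determines the ''edge order'' at $v$: at a black vertex, counterclockwise starting just after the cilium; at a white vertex, clockwise starting just after the cilium. Trace. Let $\mathcal C_v=\{1,\dots,n_v\}$. A coloring of $m$ assigns to each edge $e=bw$ with $m_e>0$ subsets $S_e\subset\mathcal C_b$, $T_e\subset\mathcal C_w$ of size $m_e$ such that at each black $b$ the sets $S_{bw}$ partition $\mathcal C_b$ and at each white $w$ the sets $T_{bw}$ partition $\mathcal C_w$. The sign $c_b$ is the signature of the permutation of $\mathcal C_b$ obtained by listing the sets $S_{bw}$ in the edge order at $b$, each in increasing order; $c_w$ is defined likewise with the sets $T_{bw}$ in the edge order at $w$. Then $\mathrm{Tr}_\Phi(m)=\sum_C\prod_v c_v\prod_{e=bw:\,m_e>0}\det[(\phi_{bw})_{T_e,S_e}]$, summing over colorings $C$, where $(\phi)_{T,S}$ is the submatrix with rows $T$ and columns $S$ in increasing order. *)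

(* Defs.v *)
From HB Require Import structures.
From mathcomp Require Import all_boot all_order all_algebra.
From mathcomp Require Import reals.
Set Implicit Arguments. Unset Strict Implicit. Unset Printing Implicit Defensive.
Import Order.TTheory GRing.Theory Num.Theory.
Local Open Scope ring_scope.

(* An edge of the honeycomb H: ((x,y), k) is the edge from b_{x,y} to
   w_{x,y} (k = 0), w_{x+1,y} (k = 1), w_{x,y+1} (k = 2). *)
Definition hedge := ((int * int) * 'I_3)%type.

Definition hshift (k : 'I_3) : int * int :=
  if val k == 0%N then (0, 0) else if val k == 1%N then (1, 0) else (0, 1).

Definition hblack (e : hedge) : int * int := e.1.
Definition hwhite (e : hedge) : int * int :=
  (e.1.1 + (hshift e.2).1, e.1.2 + (hshift e.2).2).

Definition hconn (R : numFieldType) (A B : 'M[R]_2) (e : hedge) : 'M[R]_2 :=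
  if val e.2 == 0%N then 1%:M else if val e.2 == 1%N then A else B.

Definition honeycomb_subgraph (Bs Ws : seq (int * int)) (E : seq hedge) : bool :=
  [&& uniq Bs, uniq Ws, uniq E &
      all (fun e => (hblack e \in Bs) && (hwhite e \in Ws)) E].

(* m is a 2-multiweb of (Bs, Ws, E) (only its values on E matter). *)
Definition is_2multiweb (Bs Ws : seq (int * int)) (E : seq hedge) (m : hedge -> nat) : Prop :=
  (forall p, p \in Bs -> (\sum_(e <- E | hblack e == p) m e)%N = 2%N) /\
  (forall q, q \in Ws -> (\sum_(e <- E | hwhite e == q) m e)%N = 2%N).

Definition he0 : hedge := ((0, 0), ord0).
Definition eE (E : seq hedge) (i : 'I_(size E)) : hedge := nth he0 E i.
Arguments eE : clear implicits.

(* Edges of the subgraph at a black vertex, in edge order (ccw after the cilium,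
   which points in direction (-1,0)): types 0, 1, 2. *)
Definition black_incident (E : seq hedge) (p : int * int) : seq 'I_(size E) :=
  flatten [seq [seq i <- enum 'I_(size E) |
                  (hblack (eE E i) == p) && (val (eE E i).2 == k)] | k <- [:: 0; 1; 2]%N].

(* Edges at a white vertex, in edge order (cw after the cilium, which points in
   direction (0,1)): to b_{x,y} (type 0), to b_{x,y-1} (type 2), to b_{x-1,y} (type 1). *)
Definition white_incident (E : seq hedge) (q : int * int) : seq 'I_(size E) :=
  flatten [seq [seq i <- enum 'I_(size E) |
                  (hwhite (eE E i) == q) && (val (eE E i).2 == k)] | k <- [:: 0; 2; 1]%N].

(* colors C_v = {1,2} are represented by 'I_2; a set listed in increasing order *)
Definition sorted_colors (S : {set 'I_2}) : seq 'I_2 :=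
  sort (fun i j : 'I_2 => (i <= j)%N) (enum S).

Definition ninv (s : seq 'I_2) : nat :=
  (\sum_(i < size s) \sum_(j < size s | (i < j)%N) (nth ord0 s j < nth ord0 s i))%N.
Definition seq_sign (R : numFieldType) (s : seq 'I_2) : R := (-1) ^+ ninv s.

Definition coloring (E : seq hedge) := {ffun 'I_(size E) -> {set 'I_2} * {set 'I_2}}.

Definition black_word (E : seq hedge) (c : coloring E) (p : int * int) : seq 'I_2 :=
  flatten [seq sorted_colors (c i).1 | i <- black_incident E p].
Definition white_word (E : seq hedge) (c : coloring E) (q : int * int) : seq 'I_2 :=
  flatten [seq sorted_colors (c i).2 | i <- white_incident E q].
Arguments black_word : clear implicits.
Arguments white_word : clear implicits.

(* |S_e| = |T_e| = m_e, and the S's (resp. T's) at each vertex partition the colors,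
   i.e. listing them in edge order gives a permutation of {1,2}. *)
Definition valid_coloring (Bs Ws : seq (int * int)) (E : seq hedge) (m : hedge -> nat)
    (c : coloring E) : bool :=
  [&& [forall i, (#|(c i).1| == m (eE E i)) && (#|(c i).2| == m (eE E i))],
      all (fun p => perm_eq (black_word E c p) (enum 'I_2)) Bs &
      all (fun q => perm_eq (white_word E c q) (enum 'I_2)) Ws].

(* det of the submatrix with rows T, columns S (both of size k), increasing order *)
Definition minor (R : numFieldType) (M : 'M[R]_2) (T S : {set 'I_2}) (k : nat) : R :=
  \det (\matrix_(i < k, j < k)
          M (nth ord0 (sorted_colors T) i) (nth ord0 (sorted_colors S) j)).

Definition trace2 (R : numFieldType) (A B : 'M[R]_2) (Bs Ws : seq (int * int))
    (E : seq hedge) (m : hedge -> nat) : R :=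
  \sum_(c : coloring E | valid_coloring Bs Ws m c)
    ((\prod_(p <- Bs) seq_sign R (black_word E c p)) *
     (\prod_(q <- Ws) seq_sign R (white_word E c q)) *
     \prod_(i < size E | (0 < m (eE E i))%N)
        minor (hconn A B (eE E i)) (c i).2 (c i).1 (m (eE E i))).

Definition eig_pos (R : realType) (M : 'M[R]_2) : Prop :=
  exists l1 l2 : R, [/\ 0 < l1, 0 < l2 & char_poly M = ('X - l1%:P) * ('X - l2%:P)].
Definition eig_neg (R : realType) (M : 'M[R]_2) : Prop :=
  exists l1 l2 : R, [/\ l1 < 0, l2 < 0 & char_poly M = ('X - l1%:P) * ('X - l2%:P)].

Definition sign_condition (R : realType) (A B : 'M[R]_2) : Prop :=
  let C := A *m invmx B in
  [\/ [/\ eig_pos A, eig_pos B & eig_neg C],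
      [/\ eig_pos A, eig_neg B & eig_pos C],
      [/\ eig_neg A, eig_pos B & eig_pos C] |
      [/\ eig_neg A, eig_neg B & eig_neg C]].

(* Main.v *)
Require Import Defs.
From HB Require Import structures.
From mathcomp Require Import all_boot all_order all_algebra.
From mathcomp Require Import reals ring lra.
Set Implicit Arguments. Unset Strict Implicit. Unset Printing Implicit Defensive.
Import Order.TTheory GRing.Theory Num.Theory.
Local Open Scope ring_scope.

(** The trace is the contraction of a tensor network, and the point is to choose,
    on each type of edge, a rank-one decomposition [M = p_0 q_0 + p_1 q_1] of the
    connection matrix for which every local contraction has the same sign.

    Replacing [A] by [-A] or [B] by [-B] does not change the trace: the edges of a
    given type have even total multiplicity, because that multiplicity is twice the
    difference of the coordinate sums of the white and of the black vertices.  Hence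
    [A] and [B] may be taken with positive and [A B^-1] with negative eigenvalues.

    In a basis made of an eigenvector of [B] and one of [A], these matrices are upper
    and lower triangular.  Take [u] with [A u = g B u], [g < 0], and [v = B u]; the
    vectors [p_r] are then, up to sign, basis vectors or [v], the covectors [q_r]
    annihilate basis vectors or [u], and all the 2x2 determinants formed by two edges
    at a vertex, in the cilium order, are nonnegative (up to the orientation [eta] of
    the basis, which occurs once per vertex and so an even number of times).
    Expanding every edge of multiplicity 1, the sum over colorings factors over the
    vertices into such determinants, and one choice of the terms makes all of them
    positive. *)

(** * Rank-one decompositions with nonnegative determinants *)

Definition cross (R : pzRingType) (x y : 'I_2 -> R) : R :=
  x ord0 * y ord_max - x ord_max * y ord0.

(** [ks] lists the edge types in the cilium order, and [x k r] is the vector that term [r] of the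
    decomposition puts on an edge of type [k]. Strictness is asked only of the terms [false]:
    choosing them on every edge gives the positive summand of the trace. *)
Definition frame_positive (R : realType) (ks : seq nat) (eta : R)
    (x : 'I_3 -> bool -> 'I_2 -> R) : Prop :=
  forall k l : 'I_3, (index (val k) ks < index (val l) ks)%N ->
    (forall r s, 0 <= eta * cross (x k r) (x l s)) /\
    0 < eta * cross (x k false) (x l false).

Definition pair_fun (R : Type) (x y : R) (i : 'I_2) : R :=
  if val i == 0%N then x else y.

Definition triple_fun (T : Type) (x y z : T) (k : 'I_3) : T :=
  if val k == 0%N then x else if val k == 1%N then y else z.

(** With [white_frame] this decomposes the identity, the lower triangular matrix with entries [a1],
    [a], [a2] and the upper triangular one with entries [b1], [b], [b2]. The white vectors are, up
    to sign, basis vectors or [(v, w)], which fixes the covectors here. *)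
Definition black_frame (R : realType) (a1 a2 a b1 b2 b v w : R)
    : 'I_3 -> bool -> 'I_2 -> R :=
  triple_fun
    (fun r => if r then pair_fun 0 (-1) else pair_fun 1 0)
    (fun r => if r then pair_fun (a1 / v) 0 else pair_fun (a - w * (a1 / v)) a2)
    (fun r => if r then pair_fun b1 (b - v * (b2 / w)) else pair_fun 0 (b2 / w)).

Definition white_frame (R : realType) (v w : R) : 'I_3 -> bool -> 'I_2 -> R :=
  triple_fun
    (fun r => if r then pair_fun 0 (-1) else pair_fun 1 0)
    (fun r => if r then pair_fun v w else pair_fun 0 1)
    (fun r => if r then pair_fun 1 0 else pair_fun v w).

Lemma ord2P (P : 'I_2 -> Prop) : P ord0 -> P ord_max -> forall i, P i.
Proof.
by move=> h0 h1 [[|[|//]] h]; [move: h0 | move: h1]; congr P; apply: val_inj.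
Qed.

(** Every determinant is zero or a product of positive numbers once the corrected entries [h3] and
    [h4] are known to be positive. The only delicate one, between term [false] of type 1 and term
    [true] of type 2 at a black vertex, vanishes by [h5]: these two covectors are proportional. *)
Lemma frames_positive (R : realType) (a1 a2 a b1 b2 b v w : R) :
  0 < a1 -> 0 < a2 -> 0 < b1 -> 0 < b2 -> 0 < v -> 0 < w ->
  a1 * w < a * v -> b2 * v < b * w ->
  (a * v - a1 * w) * (b * w - b2 * v) = a2 * v * (b1 * w) ->
  frame_positive [:: 0; 1; 2]%N 1 (black_frame a1 a2 a b1 b2 b v w) /\
  frame_positive [:: 0; 2; 1]%N 1 (white_frame v w).
Proof.
move=> a1p a2p b1p b2p vp wp ha hb hab.
have h1 : 0 < a1 / v by rewrite divr_gt0.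
have h2 : 0 < b2 / w by rewrite divr_gt0.
have h3 : 0 < a - w * (a1 / v).
  by rewrite mulrA subr_gt0 ltr_pdivrMr // mulrC.
have h4 : 0 < b - v * (b2 / w).
  by rewrite mulrA subr_gt0 ltr_pdivrMr // mulrC.
have h5 : (a - w * (a1 / v)) * (b - v * (b2 / w)) = a2 * b1.
  have vw0 : v * w != 0 by rewrite mulf_neq0 ?gt_eqF.
  apply: (mulIf vw0); transitivity (a2 * v * (b1 * w)); last by ring.
  by rewrite -hab; field; rewrite !gt_eqF.
split=> k l.
- case: k => [[|[|[|//]]] hk]; case: l => [[|[|[|//]]] hl] //= _;
  (split; [case; case|]); rewrite /cross /black_frame /triple_fun /pair_fun /=; nra.
- case: k => [[|[|[|//]]] hk]; case: l => [[|[|[|//]]] hl] //= _;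
  (split; [case; case|]); rewrite /cross /white_frame /triple_fun /pair_fun /=; nra.
Qed.

Lemma sum_ord2 (V : nmodType) (F : 'I_2 -> V) : \sum_i F i = F ord0 + F ord_max.
Proof.
by rewrite big_ord_recl big_ord1; congr (_ + F _); apply: val_inj.
Qed.

Lemma det_mx2 (R : comPzRingType) (M : 'M[R]_2) :
  \det M = M ord0 ord0 * M ord_max ord_max - M ord0 ord_max * M ord_max ord0.
Proof.
rewrite (expand_det_row _ ord0) sum_ord2 /cofactor !det_mx11 !mxE /=.
rewrite expr0 expr1 mul1r mulN1r mulrN.
by congr (_ * M _ _ - _ * M _ _); apply: val_inj.
Qed.

Lemma cross_mulmx (R : comPzRingType) (x y : 'I_2 -> R) (H : 'M[R]_2) :
  cross (fun s => \sum_j x j * H j s) (fun s => \sum_j y j * H j s) =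
  cross x y * \det H.
Proof. by rewrite /cross !sum_ord2 det_mx2; ring. Qed.

Lemma frame_positive_mulmx (R : realType) (ks : seq nat) (eta : R)
    (x : 'I_3 -> bool -> 'I_2 -> R) (H : 'M[R]_2) :
  0 < eta * \det H -> frame_positive ks 1 x ->
  frame_positive ks eta (fun k r s => \sum_j x k r j * H j s).
Proof.
move=> hH hx k l /hx [h0 h1]; split=> [r s|]; rewrite cross_mulmx mulrCA.
  by rewrite mulr_ge0 ?(ltW hH) //; move: (h0 r s); rewrite mul1r.
by rewrite mulr_gt0 //; move: h1; rewrite mul1r.
Qed.

Definition mx2 (R : Type) (x y z w : R) : 'M[R]_2 :=
  \matrix_(i, j) pair_fun (pair_fun x y) (pair_fun z w) i j.

(* Each connection matrix is the sum over [r] of the rank-one matrices with entries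
   [p k r t * q k r s], where [q] lives at black and [p] at white vertices. *)
Definition edge_frames (R : realType) (A B : 'M[R]_2) (eta : R)
    (q p : 'I_3 -> bool -> 'I_2 -> R) : Prop :=
  [/\ eta * eta = 1, frame_positive [:: 0; 1; 2]%N eta q,
      frame_positive [:: 0; 2; 1]%N eta p &
      forall (e : hedge) t s,
        hconn A B e t s = \sum_r p e.2 r t * q e.2 r s].

(** The vectors [p] are transported by [G] and the covectors [q] by its inverse. Their determinants
    get multiplied by [\det G] and by its inverse, which have the same sign; that sign is the new
    [eta]. *)
Lemma edge_frames_conj (R : realType) (A B A' B' G : 'M[R]_2) q p :
  G \in unitmx -> A *m G = G *m A' -> B *m G = G *m B' ->
  edge_frames A' B' 1 q p -> exists eta q p, edge_frames A B eta q p.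
Proof.
move=> uG hA hB [_ hq hp hf].
have dG : \det G != 0 by rewrite -unitfE.
have e0 : 0 < Num.sg (\det G) * \det G by rewrite -normrEsg normr_gt0.
exists (Num.sg (\det G)), (fun k r s => \sum_j q k r j * invmx G j s),
  (fun k r s => \sum_j p k r j * G^T j s); split.
- by rewrite -expr2 sqr_sg dG.
- apply: frame_positive_mulmx hq; rewrite det_inv.
  have -> : (\det G)^-1 = \det G * (\det G)^-1 ^+ 2 by field.
  by rewrite mulrA mulr_gt0 // exprn_even_gt0 //= invr_eq0.
- by apply: frame_positive_mulmx hp; rewrite det_tr.
move=> e t s.
have -> : hconn A B e = G *m hconn A' B' e *m invmx G.
  rewrite /hconn; case: ifP => _; first by rewrite mulmx1 mulmxV.
  by case: ifP => _; rewrite -?hA -?hB mulmxK.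
rewrite big_bool /= mxE !sum_ord2 !mxE !sum_ord2 !hf !big_bool /= ?mxE; ring.
Qed.

(** The vector [(u, t)] is sent by the first matrix to [g] times its image [(v, w)] under the
    second. The signs are then forced: [w > 0], the second equation gives [u < 0], and the first
    gives [v > 0]. *)
Lemma triangular_edge_frames (R : realType) (a1 a2 a b1 b2 b u t g : R) :
  0 < a1 -> 0 < a2 -> 0 < b1 -> 0 < b2 -> 0 < a -> g < 0 ->
  0 < t -> a1 * u = g * (b1 * u + b * t) -> a * u + a2 * t = g * (b2 * t) ->
  exists q p, edge_frames (mx2 a1 0 a a2) (mx2 b1 b 0 b2) 1 q p.
Proof.
move=> a1p a2p b1p b2p ap gn tp e1 e2.
set v := b1 * u + b * t; set w := b2 * t.
have wp : 0 < w by rewrite mulr_gt0.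
have un : u < 0.
  have h1 : 0 < a2 * t by rewrite mulr_gt0.
  have h2 : g * w < 0 by rewrite nmulr_rlt0.
  by rewrite -(pmulr_rlt0 _ ap); move: e2; rewrite -/w; lra.
have vp : 0 < v by rewrite -(nmulr_rlt0 _ gn) -e1 pmulr_rlt0.
(* Multiplying by [g] lets the two equations replace [g * v] and [g * w] by expressions in [u] and
   [t]; the terms in [u] cancel. *)
have hk : g * (a * v - a1 * w) = - (a1 * a2 * t).
  have -> : g * (a * v - a1 * w) = a * (g * v) - a1 * (g * w) by ring.
  by rewrite -e1 -e2; ring.
have ha : a1 * w < a * v.
  rewrite -subr_gt0 -(nmulr_rlt0 _ gn) hk oppr_lt0.
  by rewrite !mulr_gt0.
have hb : b2 * v < b * w.
  have -> : b * w = b2 * v - b1 * b2 * u by rewrite /v /w; ring.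
  by rewrite ltrBrDr gtrDl pmulr_rlt0 ?mulr_gt0.
(* After multiplication by [g], both sides equal [a1 * a2 * b1 * b2 * u * t]. *)
have hab : (a * v - a1 * w) * (b * w - b2 * v) = a2 * v * (b1 * w).
  have g0 : g != 0 by rewrite lt_eqF.
  apply: (mulfI g0).
  transitivity (g * (a * v - a1 * w) * (b * w - b2 * v)); first by ring.
  transitivity (a2 * (g * v) * (b1 * w)); last by ring.
  by rewrite hk -e1 /v /w; ring.
have [hq hp] := frames_positive a1p a2p b1p b2p vp wp ha hb hab.
exists (black_frame a1 a2 a b1 b2 b v w), (white_frame v w); split=> //.
  by rewrite mulr1.
have v0 : v != 0 by rewrite gt_eqF.
have w0 : w != 0 by rewrite gt_eqF.
case=> e k; elim/ord2P=> s; elim/ord2P: s; case: k => [[|[|[|//]]] ?];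
  rewrite /hconn big_bool /white_frame /black_frame /triple_fun ?mxE /pair_fun /=;
  by field; rewrite ?v0 ?w0.
Qed.

(** * Eigenvectors and simultaneous triangularization *)

Lemma char_poly_tr (R : comNzRingType) n (M : 'M[R]_n) : char_poly M^T = char_poly M.
Proof.
rewrite /char_poly -[RHS]det_tr; congr (\det _).
by rewrite /char_poly_mx linearB /= tr_scalar_mx map_trmx.
Qed.

(** The predicate [eigenvalue] concerns row vectors, so the transpose is used. *)
Lemma col_eigenvector (F : fieldType) n (M : 'M[F]_n) l :
  root (char_poly M) l -> exists2 v : 'cV_n, M *m v = l *: v & v != 0.
Proof.
rewrite -char_poly_tr -eigenvalue_root_char => /eigenvalueP [v hv v0].
exists v^T; last by rewrite trmx_eq0.
by rewrite -[M]trmxK -trmx_mul hv linearZ.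
Qed.

Lemma eigenvector_root (F : fieldType) n (M : 'M[F]_n) l (v : 'cV_n) :
  M *m v = l *: v -> v != 0 -> root (char_poly M) l.
Proof.
move=> hv v0; rewrite -char_poly_tr -eigenvalue_root_char.
apply/eigenvalueP; exists v^T; last by rewrite trmx_eq0.
by rewrite -trmx_mul hv linearZ.
Qed.

Lemma eig_pos_spec (R : realType) (M : 'M[R]_2) : eig_pos M ->
  0 < \det M /\ exists l, 0 < l /\ root (char_poly M) l.
Proof.
move=> [l1 [l2 [p1 p2 hM]]]; split; last first.
  by exists l1; split=> //; rewrite hM rootM root_XsubC eqxx.
have := char_poly_det M; rewrite hM -horner_coef0 !hornerE /= sqrrN expr1n mul1r.
by move=> <-; rewrite mulrNN mulr_gt0.
Qed.

Lemma eig_neg_spec (R : realType) (M : 'M[R]_2) : eig_neg M ->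
  (exists l, l < 0 /\ root (char_poly M) l) /\
  (forall l, root (char_poly M) l -> l < 0).
Proof.
move=> [l1 [l2 [p1 p2 ->]]]; split.
  by exists l1; split=> //; rewrite rootM root_XsubC eqxx.
by move=> l; rewrite rootM !root_XsubC => /orP [] /eqP ->.
Qed.

Lemma cV2_eq0 (R : nmodType) (v : 'cV[R]_2) :
  v ord0 ord0 = 0 -> v ord_max ord0 = 0 -> v = 0.
Proof. by move=> h0 h1; apply/colP; elim/ord2P; rewrite mxE. Qed.

Lemma mx2E (R : Type) (M : 'M[R]_2) :
  M = mx2 (M ord0 ord0) (M ord0 ord_max) (M ord_max ord0) (M ord_max ord_max).
Proof.
by apply/matrixP; elim/ord2P; elim/ord2P; rewrite mxE.
Qed.

(** In the basis [f], [g] of eigenvectors of [B] and [A], the triangular case applies after two sign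
    normalizations: the eigenvector may be negated to get [t > 0], and the first basis vector to
    make the lower left entry of [A'] positive. *)
Lemma exists_edge_frames (R : realType) (A B : 'M[R]_2) :
  B \in unitmx -> eig_pos A -> eig_pos B -> eig_neg (A *m invmx B) ->
  exists eta q p, edge_frames A B eta q p.
Proof.
move=> uB /eig_pos_spec [dA [a2 [a2p rA]]] /eig_pos_spec [dB [b1 [b1p rB]]].
move=> /eig_neg_spec [[gam [gn rC]] hC].
have [g hg g0] := col_eigenvector rA.
have [f hf f0] := col_eigenvector rB.
have [v hv v0] := col_eigenvector rC.
pose G := \matrix_(i, j) pair_fun (f i ord0) (g i ord0) j : 'M[R]_2.
have Gf : G *m delta_mx ord0 0 = f.
  by apply/colP=> i; rewrite -colE !mxE /=.
have Gg : G *m delta_mx ord_max 0 = g.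
  by apply/colP=> i; rewrite -colE !mxE /=.
(* If [f] and [g] were dependent, [g] would be a common eigenvector of [A] and [B], and
   [a2 / b1 > 0] an eigenvalue of [A *m invmx B], whose eigenvalues are negative. *)
have uG : G \in unitmx.
  rewrite unitmxE unitfE -det_tr; apply/det0P => -[z z0 hz].
  have {}hz : z 0 ord0 *: f + z 0 ord_max *: g = 0.
    apply/colP => i; move/rowP/(_ i): hz.
    by rewrite !mxE sum_ord2 !mxE.
  have z10 : z 0 ord_max != 0.
    apply: contraNneq z0 => z1; move/eqP: hz.
    rewrite z1 scale0r addr0 scaler_eq0 (negPf f0) orbF => /eqP z00.
    by apply/eqP/rowP; elim/ord2P; rewrite mxE.
  have hgf : g = (- (z 0 ord0 / z 0 ord_max)) *: f.
    apply: (scalerI z10); rewrite scalerA mulrN mulrCA divff // mulr1 scaleNr.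
    by apply/eqP; rewrite -addr_eq0 addrC hz.
  have hBg : B *m g = b1 *: g by rewrite hgf -scalemxAr hf !scalerA mulrC.
  have /hC : root (char_poly (A *m invmx B)) (a2 / b1).
    apply: (eigenvector_root _ g0).
    have -> : A *m invmx B *m g = A *m (b1^-1 *: g).
      rewrite -mulmxA; congr (_ *m _).
      apply: (can_inj (mulKmx uB)); rewrite mulKVmx // -scalemxAr hBg.
      by rewrite scalerA mulVf ?gt_eqF // scale1r.
    by rewrite -scalemxAr hg scalerA mulrC.
  by rewrite ltNge ltW // divr_gt0.
pose A' := invmx G *m (A *m G); pose B' := invmx G *m (B *m G).
have AG : A *m G = G *m A' by rewrite mulKVmx.
have BG : B *m G = G *m B' by rewrite mulKVmx.
have hA' : A' *m delta_mx ord_max 0 = a2 *: delta_mx ord_max 0 :> 'cV_2.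
  by rewrite /A' -!mulmxA Gg hg -scalemxAr -{1}Gg mulKmx.
have hB' : B' *m delta_mx ord0 0 = b1 *: delta_mx ord0 0 :> 'cV_2.
  by rewrite /B' -!mulmxA Gf hf -scalemxAr -{1}Gf mulKmx.
move: hA' hB'; rewrite -!colE => /colP hA' /colP hB'.
have A01 : A' ord0 ord_max = 0 by have := hA' ord0; rewrite !mxE mulr0.
have A11 : A' ord_max ord_max = a2 by have := hA' ord_max; rewrite !mxE mulr1.
have B10 : B' ord_max ord0 = 0 by have := hB' ord_max; rewrite !mxE mulr0.
have B00 : B' ord0 ord0 = b1 by have := hB' ord0; rewrite !mxE mulr1.
have dG : \det G != 0 by rewrite -unitfE.
have dA' : \det A' = \det A.
  by rewrite !det_mulmx det_inv mulrC mulfK.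
have dB' : \det B' = \det B.
  by rewrite !det_mulmx det_inv mulrC mulfK.
(* The determinant and one diagonal entry are positive, hence so is the other diagonal entry. *)
have a1p : 0 < A' ord0 ord0.
  by move: dA; rewrite -dA' det_mx2 A01 A11 mul0r subr0 pmulr_lgt0.
have b2p : 0 < B' ord_max ord_max.
  by move: dB; rewrite -dB' det_mx2 B10 B00 mulr0 subr0 pmulr_rgt0.
(* These are the coordinates of [invmx B *m v] in the new basis; the eigenvector equation of
   [A *m invmx B] becomes [A' *m x = gam *: (B' *m x)]. *)
pose x := invmx G *m (invmx B *m v).
have x0 : x != 0.
  apply: contraNneq v0 => hx.
  have -> : v = B *m (G *m x) by rewrite /x mulKVmx // mulKVmx.
  by rewrite hx !mulmx0.
have hx : A' *m x = gam *: (B' *m x).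
  rewrite /A' /B' /x -!mulmxA !mulKVmx //.
  by rewrite (mulmxA A) hv scalemxAr.
clearbody x A' B'.
have [e1 e2] : A' ord0 ord0 * x ord0 0 = gam * (b1 * x ord0 0 + B' ord0 ord_max * x ord_max 0)
  /\ A' ord_max ord0 * x ord0 0 + a2 * x ord_max 0 = gam * (B' ord_max ord_max * x ord_max 0).
  move/colP: hx => hx; split; [move: (hx ord0) | move: (hx ord_max)];
  by rewrite !mxE !sum_ord2 ?A01 ?A11 ?B10 ?B00 ?mul0r ?addr0 ?add0r.
(* Otherwise the first equation says that [A' ord0 ord0 - gam * b1], which is positive, kills the
   first coordinate, so [x] is zero. *)
have t0 : x ord_max 0 != 0.
  apply: contraNneq x0 => t0; apply/eqP; apply: cV2_eq0 => //.
  move: e1; rewrite t0 mulr0 addr0 mulrA => /eqP; rewrite -subr_eq0 -mulrBl mulf_eq0.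
  have : 0 < A' ord0 ord0 - gam * b1 by rewrite subr_gt0 (lt_trans _ a1p) // nmulr_rlt0.
  by move=> /gt_eqF -> /= /eqP.
have [u [t [tp {}e1 {}e2]]] : exists u t, [/\ 0 < t,
    A' ord0 ord0 * u = gam * (b1 * u + B' ord0 ord_max * t) &
    A' ord_max ord0 * u + a2 * t = gam * (B' ord_max ord_max * t)].
  case: (ltrP 0 (x ord_max 0)) => ht; first by exists (x ord0 0), (x ord_max 0).
  exists (- x ord0 0), (- x ord_max 0).
  by split; [rewrite oppr_gt0 lt_neqAle t0 | rewrite !mulrN -opprD mulrN e1
    | rewrite !mulrN -opprD e2].
rewrite (mx2E A') A01 A11 in AG; rewrite (mx2E B') B10 B00 in BG.
(* If this entry were zero, the second equation would equate a positive and a negative number. *)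
have a0 : A' ord_max ord0 != 0.
  apply/eqP => a0; have : 0 < a2 * t by rewrite mulr_gt0.
  have : gam * (B' ord_max ord_max * t) < 0 by rewrite nmulr_rlt0 ?mulr_gt0.
  by rewrite -e2 a0; lra.
case: (ltrP 0 (A' ord_max ord0)) => ha.
  have [q [p hqp]] := triangular_edge_frames a1p a2p b1p b2p ha gn tp e1 e2.
  exact: edge_frames_conj uG AG BG hqp.
have {}ha : 0 < - A' ord_max ord0 by rewrite oppr_gt0 lt_neqAle a0.
have [|| q [p hqp]] := @triangular_edge_frames _ _ _ _ _ _ (- B' ord0 ord_max) (- u)
   _ _ a1p a2p b1p b2p ha gn tp.
- by rewrite !mulrN mulNr -opprD mulrN e1.
- by rewrite mulrNN e2.
(* Negating the first basis vector changes the sign of both off-diagonal entries and of [u], and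
   keeps the diagonals. *)
pose D := mx2 (-1) 0 0 1 : 'M[R]_2.
apply: (edge_frames_conj (G := G *m D)) hqp.
- by rewrite unitmx_mul uG unitmxE det_mx2 !mxE /= mul0r subr0 mulN1r unitrN unitr1.
- rewrite mulmxA AG -!mulmxA; congr (_ *m _).
  by apply/matrixP; elim/ord2P; elim/ord2P; rewrite !mxE !sum_ord2 !mxE /pair_fun /=; ring.
- rewrite mulmxA BG -!mulmxA; congr (_ *m _).
  by apply/matrixP; elim/ord2P; elim/ord2P; rewrite !mxE !sum_ord2 !mxE /pair_fun /=; ring.
Qed.

(** * Factorization of sums over local data, and color words *)

(** A function on [I] amounts to the family of its restrictions to the fibers of [h]. A restriction
    is encoded as a function on all of [I] with the default [x0] off its fiber, so that its type
    does not depend on [v]; distributivity does the rest. *)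
Lemma sum_prod_fiber (R : comNzRingType) (I V X : finType) (x0 : X) (h : I -> V)
    (F : V -> {ffun I -> X} -> R) :
  (forall v (S S' : {ffun I -> X}),
     (forall i, h i = v -> S i = S' i) -> F v S = F v S') ->
  \sum_S \prod_v F v S =
  \prod_v \sum_(S : {ffun I -> X} | [forall i, (h i != v) ==> (S i == x0)]) F v S.
Proof.
move=> loc; rewrite bigA_distr_big_dep.
pose g (S : {ffun I -> X}) : {ffun V -> {ffun I -> X}} :=
  [ffun v => [ffun i => if h i == v then S i else x0]].
pose g' (f : {ffun V -> {ffun I -> X}}) : {ffun I -> X} := [ffun i => f (h i) i].
rewrite [RHS](reindex_onto g g') => [|f /familyP hf]; last first.
  apply/ffunP=> v; apply/ffunP=> i; rewrite !ffunE.
  case: eqVneq => [<-|hv] //; apply/esym/eqP.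
  by have /forallP /(_ i) /implyP := hf v; apply.
apply: eq_big => [S|S _].
  apply/esym/andP; split; last by apply/eqP/ffunP=> i; rewrite !ffunE eqxx.
  apply/familyP=> v; apply/forallP=> i; apply/implyP=> hv.
  by rewrite !ffunE (negPf hv).
by apply: eq_bigr => v _; apply: loc => i hi; rewrite !ffunE hi eqxx.
Qed.

Lemma filter_sum2 (T : Type) (L : seq T) (m : T -> nat) :
  (\sum_(i <- L) m i)%N = 2%N ->
  (exists2 i, [seq i <- L | (0 < m i)%N] = [:: i] & m i = 2%N) \/
  (exists i j, [/\ [seq i <- L | (0 < m i)%N] = [:: i; j], m i = 1%N & m j = 1%N]).
Proof.
have -> : (\sum_(i <- L) m i = \sum_(i <- [seq i <- L | 0 < m i]) m i)%N.
  by rewrite big_filter [RHS]big_mkcond; apply: eq_bigr => i _; case: (m i).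
have := filter_all (fun i => 0 < m i)%N L.
case: [seq i <- L | _] => [|i [|j [|k s]]]; rewrite ?big_cons ?big_nil //=.
- by rewrite addn0; left; exists i.
- rewrite addn0 andbT => /andP [hi hj] h2; right; exists i, j; split=> //.
    by apply/eqP; rewrite eqn_leq hi andbT -ltnS -h2 -[X in (X < _)%N]addn0 ltn_add2l.
  by apply/eqP; rewrite eqn_leq hj andbT -ltnS -h2 -[X in (X < _)%N]add0n ltn_add2r.
- move=> /and4P [hi hj hk _] h2.
  suff : (3 <= 2)%N by [].
  by rewrite -[X in (_ <= X)%N]h2 !addnA -[3%N]/(1 + 1 + 1 + 0)%N !leq_add.
Qed.

Lemma enum_ord2 : enum 'I_2 = [:: ord0; ord_max].
Proof.
rewrite enum_ordSl enum_ordSl /= (size0nil (size_enum_ord 0)) /=.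
by congr [:: _; _]; apply: val_inj.
Qed.

Lemma sorted_colors0 : sorted_colors set0 = [::].
Proof. by rewrite /sorted_colors enum_set0. Qed.

Lemma sorted_colors1 a : sorted_colors [set a] = [:: a].
Proof. by rewrite /sorted_colors enum_set1. Qed.

Lemma sorted_colorsT : sorted_colors setT = [:: ord0; ord_max].
Proof. by rewrite /sorted_colors enum_setT -enumT enum_ord2. Qed.

Lemma seq_sign01 (R : numFieldType) : seq_sign R [:: ord0; ord_max] = 1.
Proof.
rewrite /seq_sign /ninv /=.
under eq_bigr do rewrite big_mkcond.
by rewrite !big_ord_recl !big_ord0 /= ?expr0 ?expr1.
Qed.

Lemma seq_sign10 (R : numFieldType) : seq_sign R [:: ord_max; ord0] = -1.
Proof.
rewrite /seq_sign /ninv /=.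
under eq_bigr do rewrite big_mkcond.
by rewrite !big_ord_recl !big_ord0 /= ?expr0 ?expr1.
Qed.

(** * Contraction of the half-edges at one vertex *)

Lemma pairwise_subsingleton (T : eqType) (r : rel T) (s : seq T) :
  uniq s -> {in s &, forall x y, x = y} -> pairwise r s.
Proof.
case: s => [|x [|y s]] //= /andP [hx _] /(_ x y).
by rewrite !inE !eqxx orbT => /(_ isT isT) hxy; rewrite hxy inE eqxx in hx.
Qed.

(** Common form of [black_incident] ([hblack], order 0, 1, 2) and [white_incident] ([hwhite], order
    0, 2, 1), so that both colors of vertices are treated at once. *)
Definition incident (h : hedge -> int * int) (ks : seq nat) (E : seq hedge)
    (p : int * int) : seq 'I_(size E) :=
  flatten [seq [seq i <- enum 'I_(size E) |
                  (h (eE E i) == p) && (val (eE E i).2 == k)] | k <- ks].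
Arguments incident : clear implicits.

Definition half_word h ks (E : seq hedge) (S : {ffun 'I_(size E) -> {set 'I_2}}) p :=
  flatten [seq sorted_colors (S i) | i <- incident h ks E p].

(* Factor of a half-edge of multiplicity [k] carrying the color set [S]; for [k = 1]
   the set is a singleton, so the sum has one term. *)
Definition half_weight (R : pzRingType) (k : nat) (x : 'I_2 -> R) (y : R)
    (S : {set 'I_2}) : R :=
  if k == 1%N then \sum_(s in S) x s else if k == 2%N then y else 1.

Section HalfEdges.

Variables (R : realType) (h : hedge -> int * int) (ks : seq nat).
Variables (E : seq hedge) (V : seq (int * int)) (m : hedge -> nat).
Hypothesis h_inj : forall e e', h e = h e' -> e.2 = e'.2 -> e = e'.
Hypothesis ks_perm : perm_eq ks [:: 0; 1; 2]%N.
Hypothesis E_uniq : uniq E.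
Hypothesis V_uniq : uniq V.
Hypothesis hE : forall e, e \in E -> h e \in V.
Hypothesis h_sum : forall p, p \in V -> (\sum_(e <- E | h e == p) m e)%N = 2%N.

Let n := size E.
Let inc p := incident h ks E p.
Let me (i : 'I_n) := m (eE E i).
Let vx (i : 'I_n) := h (eE E i).
Let rk (i : 'I_n) := index (val (eE E i).2) ks.

Lemma mem_incident p i : (i \in inc p) = (vx i == p).
Proof.
apply/flatten_mapP/eqP => [[k _]|<-].
  by rewrite mem_filter => /andP [/andP [/eqP]].
exists (val (eE E i).2); last by rewrite mem_filter !eqxx mem_enum.
by rewrite (perm_mem ks_perm); case: (eE E i).2 => [[|[|[|]]]].
Qed.

Lemma eE_inj : injective (eE E).
Proof.
by move=> i j /eqP; rewrite /eE nth_uniq // => /eqP; apply: val_inj.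
Qed.

(** A vertex and a type determine the edge, so each block of the list has at most one element, and
    the blocks follow [ks]. *)
Lemma pairwise_incident p : pairwise (fun i j => rk i < rk j)%N (inc p).
Proof.
have f1 k : pairwise (fun i j => rk i < rk j)%N [seq i <- enum 'I_(size E) |
                  (h (eE E i) == p) && (val (eE E i).2 == k)].
  apply: pairwise_subsingleton; first by rewrite filter_uniq ?enum_uniq.
  move=> i j; rewrite !mem_filter => /andP [/andP [/eqP hi /eqP ki] _].
  move=> /andP [/andP [/eqP hj /eqP kj] _]; apply: eE_inj; apply: h_inj.
    by rewrite hi.
  by apply: val_inj; rewrite /= ki.
rewrite /inc /incident; move: (perm_uniq ks_perm) (perm_size ks_perm).
rewrite /rk in f1 *; case: ks f1 => [|k0 [|k1 [|k2 [|//]]]] //= f1 hu _.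
rewrite cats0 !pairwise_cat !f1 !andbT allrel_catr.
move: hu; rewrite !inE !negb_or andbT => /andP [/andP [h01 h02] h12].
have rel k l : (index k [:: k0; k1; k2] < index l [:: k0; k1; k2])%N ->
    allrel (fun i j : 'I_n => index (val (eE E i).2) [:: k0; k1; k2]
                       < index (val (eE E j).2) [:: k0; k1; k2])%N
      [seq i <- enum 'I_(size E) | (h (eE E i) == p) && (val (eE E i).2 == k)]
      [seq i <- enum 'I_(size E) | (h (eE E i) == p) && (val (eE E i).2 == l)].
  move=> hkl; apply/allrelP=> i j; rewrite !mem_filter.
  by move=> /andP [/andP [_ /eqP ->] _] /andP [/andP [_ /eqP ->] _].
by rewrite !rel //= ?eqxx ?(negPf h01) ?(negPf h02) ?(negPf h12).
Qed.

Lemma sum_incident p : p \in V -> (\sum_(i <- inc p) me i)%N = 2%N.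
Proof.
move=> /h_sum <-; rewrite (perm_big [seq i <- enum 'I_n | vx i == p]) /=.
  rewrite big_filter big_enum_cond (big_nth he0) big_mkord.
  by apply: eq_bigl => i; rewrite andTb.
apply: uniq_perm => [||i].
- apply: pairwise_uniq (pairwise_incident p).
  by move=> i; rewrite /= ltnn.
- by rewrite filter_uniq ?enum_uniq.
- by rewrite mem_incident mem_filter mem_enum andbT.
Qed.

Lemma half_word_filter (S : {ffun 'I_n -> {set 'I_2}}) p :
  (forall i, vx i = p -> me i = 0%N -> S i = set0) ->
  half_word h ks S p =
  flatten [seq sorted_colors (S i) | i <- [seq i <- inc p | (0 < me i)%N]].
Proof.
move=> hS; have {}hS i : i \in inc p -> me i = 0%N -> S i = set0.
  by rewrite mem_incident => /eqP; apply: hS.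
rewrite /half_word -/(inc p); elim: (inc p) hS => //= i s IH hS.
rewrite IH => [|k hk]; last by apply: hS; rewrite inE hk orbT.
case: posnP => // /(hS i (mem_head _ _)) ->.
by rewrite sorted_colors0.
Qed.

Definition half_ok (S : {ffun 'I_n -> {set 'I_2}}) p : bool :=
  [forall i, (vx i == p) ==> (#|S i| == me i)] &&
  perm_eq (half_word h ks S p) (enum 'I_2).

Variables (x : 'I_n -> 'I_2 -> R) (y : 'I_n -> R).

(** The local contraction at [p]. Colorings of the half-edges at [p] are encoded as functions on all
    edges that are empty elsewhere, the form produced by [sum_prod_fiber]. *)
Definition vertex_sum p : R :=
  \sum_(S : {ffun 'I_n -> {set 'I_2}} | [forall i, (vx i != p) ==> (S i == set0)])
    if half_ok S p then
      seq_sign R (half_word h ks S p) *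
      \prod_(i | vx i == p) half_weight (me i) (x i) (y i) (S i)
    else 0.

(** The double edge must carry both colors; the word is then increasing and has sign 1. *)
Lemma vertex_sum_double p i :
  [seq i <- inc p | (0 < me i)%N] = [:: i] -> me i = 2%N -> vertex_sum p = y i.
Proof.
move=> hf mi.
have /andP [_ vi] : (0 < me i)%N && (vx i == p).
  by rewrite -mem_incident -(mem_filter (fun i => 0 < me i)%N) hf mem_head.
have m0 k : vx k = p -> k != i -> me k = 0%N.
  move=> vk; apply: contraNeq; rewrite -lt0n => mk.
  by rewrite -mem_seq1 -hf mem_filter mk mem_incident vk eqxx.
pose S0 : {ffun 'I_n -> {set 'I_2}} := [ffun k => if k == i then setT else set0].
have wS0 : half_word h ks S0 p = [:: ord0; ord_max].
  rewrite half_word_filter => [|k vk mk].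
    by rewrite hf /= ffunE eqxx sorted_colorsT.
  by rewrite ffunE; case: eqP => // hk; rewrite hk mi in mk.
rewrite /vertex_sum -big_mkcondr (big_pred1 S0) => [|S] /=.
  rewrite wS0 seq_sign01 mul1r (bigD1 i) //= {1}/half_weight mi /=.
  rewrite big1 ?mulr1 // => k /andP [/eqP vk ki].
  by rewrite /half_weight m0.
apply/idP/eqP => [/andP [/forallP hs /andP [/forallP hc _]]|->].
  apply/ffunP=> k; rewrite ffunE; case: eqVneq => [->|ki].
    have := hc i; rewrite vi mi /= => /eqP ci.
    by apply/eqP; rewrite eqEcard subsetT cardsT card_ord ci.
  case: (eqVneq (vx k) p) => vk; last by have := hs k; rewrite vk => /eqP.
  by have := hc k; rewrite vk eqxx m0 //= cards_eq0 => /eqP.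
apply/andP; split.
  apply/forallP=> k; apply/implyP=> vk; rewrite ffunE; case: (k =P i) => // ki.
  by rewrite ki vi in vk.
apply/andP; split; last by rewrite wS0 enum_ord2.
apply/forallP=> k; apply/implyP=> /eqP vk; rewrite ffunE.
by case: (eqVneq k i) => [->|ki]; [rewrite cardsT card_ord mi | rewrite cards0 m0].
Qed.

(** There are two colorings, with words of opposite signs, and they give the two terms of the
    determinant. *)
Lemma vertex_sum_simple p i j :
  [seq i <- inc p | (0 < me i)%N] = [:: i; j] -> me i = 1%N -> me j = 1%N ->
  i != j -> vertex_sum p = cross (x i) (x j).
Proof.
move=> hf mi mj ij.
have /andP [_ vi] : (0 < me i)%N && (vx i == p).
  by rewrite -mem_incident -(mem_filter (fun i => 0 < me i)%N) hf mem_head.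
have /andP [_ vj] : (0 < me j)%N && (vx j == p).
  by rewrite -mem_incident -(mem_filter (fun i => 0 < me i)%N) hf !inE eqxx orbT.
have m0 k : vx k = p -> k != i -> k != j -> me k = 0%N.
  move=> vk ki; apply: contraNeq; rewrite -lt0n => mk.
  have : k \in [:: i; j] by rewrite -hf mem_filter mk mem_incident vk eqxx.
  by rewrite !inE (negPf ki).
pose S0 a b : {ffun 'I_n -> {set 'I_2}} :=
  [ffun k => if k == i then [set a] else if k == j then [set b] else set0].
have S0i a b : S0 a b i = [set a] by rewrite ffunE eqxx.
have S0j a b : S0 a b j = [set b] by rewrite ffunE eq_sym (negPf ij) eqxx.
have wS a b : half_word h ks (S0 a b) p = [:: a; b].
  rewrite half_word_filter => [|k vk mk].
    by rewrite hf /= S0i S0j !sorted_colors1.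
  rewrite ffunE; case: eqP => [hk|_]; first by rewrite hk mi in mk.
  by case: eqP => // hk; rewrite hk mj in mk.
have wt a b : \prod_(k | vx k == p) half_weight (me k) (x k) (y k) (S0 a b k) =
    x i a * x j b.
  rewrite (bigD1 i) //= (bigD1 j) ?vj 1?eq_sym //= /half_weight mi mj /= S0i S0j.
  rewrite !big_set1 big1 ?mulr1 // => k /andP [/andP [/eqP vk ki] kj].
  by rewrite m0.
rewrite /vertex_sum -big_mkcondr.
have S01 : S0 ord0 ord_max != S0 ord_max ord0.
  apply/eqP => /ffunP /(_ i); rewrite !S0i => /setP /(_ ord0).
  by rewrite !inE eqxx.
transitivity (\sum_(S in [:: S0 ord0 ord_max; S0 ord_max ord0])
    seq_sign R (half_word h ks S p) *
      \prod_(i | vx i == p) half_weight (me i) (x i) (y i) (S i)); last first.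
  rewrite -big_uniq /=; last by rewrite inE S01.
  rewrite !big_cons big_nil !wS !wt seq_sign01 seq_sign10 /cross; ring.
apply: eq_bigl => S.
have okS a b : a != b -> [forall k, (vx k != p) ==> (S0 a b k == set0)] && half_ok (S0 a b) p.
  move=> ab; apply/andP; split.
    apply/forallP=> k; apply/implyP=> vk; rewrite ffunE.
    case: (k =P i) => [ki|_]; first by rewrite ki vi in vk.
    by case: (k =P j) => // kj; rewrite kj vj in vk.
  apply/andP; split.
    apply/forallP=> k; apply/implyP=> /eqP vk; rewrite ffunE.
    case: (eqVneq k i) => [->|ki]; first by rewrite cards1 mi.
    by case: (eqVneq k j) => [->|kj]; [rewrite cards1 mj | rewrite cards0 m0].
  rewrite wS enum_ord2; apply: uniq_perm => [|//|k]; rewrite /= !inE ?andbT //.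
  by case: a b k ab => [[|[|//]] ?] [[|[|//]] ?] [[|[|//]] ?].
rewrite !inE; apply/idP/orP => [|[]/eqP ->]; try exact: okS.
move=> /andP [/forallP hs /andP [/forallP hc hw]].
have [a Sa] : exists a, S i = [set a].
  by apply/cards1P; have := hc i; rewrite vi mi.
have [b Sb] : exists b, S j = [set b].
  by apply/cards1P; have := hc j; rewrite vj mj.
have SE : S = S0 a b.
  apply/ffunP=> k; rewrite ffunE; case: eqVneq => [->//|ki].
  case: eqVneq => [->//|kj].
  case: (eqVneq (vx k) p) => vk; last by have := hs k; rewrite vk => /eqP.
  by have := hc k; rewrite vk eqxx m0 //= cards_eq0 => /eqP.
(* The word [[:: a; b]] has no repetition, which leaves the two colorings listed. *)
move: hw; rewrite SE wS => /perm_uniq; rewrite enum_uniq /= inE andbT.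
move: a b {Sa Sb SE}; elim/ord2P; elim/ord2P; rewrite ?eqxx //= => _; by [left | right].
Qed.

Lemma vertex_sum_cases p : p \in V ->
  (exists2 i, me i = 2%N & vertex_sum p = y i) \/
  (exists i j, [/\ me i = 1%N, me j = 1%N, (rk i < rk j)%N &
     vertex_sum p = cross (x i) (x j)]).
Proof.
move=> hp; have [[i hf mi]|[i [j [hf mi mj]]]] := filter_sum2 (sum_incident hp).
  by left; exists i; rewrite // (vertex_sum_double hf mi).
right; exists i, j; have ij : (rk i < rk j)%N.
  have : pairwise (fun i j => rk i < rk j)%N [:: i; j].
    by rewrite -hf pairwise_filter // pairwise_incident.
  by rewrite /= !andbT.
split=> //; apply: vertex_sum_simple => //.
by apply: contraTneq ij => ->; rewrite ltnn.
Qed.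

(** Validity, sign and weight at a vertex depend only on the sets on its own half-edges, and each
    edge has exactly one endpoint of the color considered, so the sum factors over [V]. *)
Lemma sum_half_colorings :
  \sum_(S : {ffun 'I_n -> {set 'I_2}} |
        [forall i, #|S i| == me i] &&
        all (fun p => perm_eq (half_word h ks S p) (enum 'I_2)) V)
    (\prod_(p <- V) seq_sign R (half_word h ks S p)) *
    \prod_i half_weight (me i) (x i) (y i) (S i)
  = \prod_(p <- V) vertex_sum p.
Proof.
(* Vertices are replaced by their positions in [V], since the factorization needs a finite type of
   vertices. *)
have [h' hh'] : exists h' : 'I_n -> 'I_(size V), forall i, nth (0, 0) V (h' i) = vx i.
  apply: (@fin_all_exists _ (fun=> 'I_(size V)) (fun i v => nth (0, 0) V v = vx i)) => i.
  have hi : vx i \in V by apply: hE; rewrite mem_nth.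
  have hlt : (index (vx i) V < size V)%N by rewrite index_mem.
  by exists (Ordinal hlt); rewrite /= nth_index.
have h'E i v : (h' i == v) = (vx i == nth (0, 0) V v).
  by rewrite -hh' nth_uniq.
rewrite [RHS](big_nth (0, 0)) big_mkord big_mkcond /=.
pose F (v : 'I_(size V)) (S : {ffun 'I_n -> {set 'I_2}}) : R :=
  let p := nth (0, 0) V v in
  if half_ok S p then
    seq_sign R (half_word h ks S p) *
    \prod_(i | vx i == p) half_weight (me i) (x i) (y i) (S i)
  else 0.
transitivity (\sum_S \prod_v F v S).
  apply: eq_bigr => S _; case: ifP => [/andP [/forallP hc /allP hw]|hn].
    rewrite (big_nth (0, 0)) big_mkord [X in _ * X](partition_big h' xpredT) //=.
    rewrite -big_split; apply: eq_bigr => v _.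
    rewrite /F /half_ok hw ?mem_nth // andbT ifT.
      by congr (_ * _); apply: eq_bigl => i; rewrite h'E.
    by apply/forallP=> i; rewrite hc implybT.
  (* An invalid assignment fails at some vertex, where its factor is 0. *)
  suff [v hv] : exists v : 'I_(size V), ~~ half_ok S (nth (0, 0) V v).
    by rewrite (bigD1 v) //= /F (negPf hv) mul0r.
  apply/existsP; apply: contraFT hn; rewrite negb_exists => /forallP hv.
  apply/andP; split.
    apply/forallP => i; have := hv (h' i); rewrite negbK hh' => /andP [].
    by move=> /forallP /(_ i); rewrite eqxx.
  apply/(all_nthP (0, 0)) => v vlt; have := hv (Ordinal vlt).
  by rewrite negbK => /andP [].
rewrite (@sum_prod_fiber _ _ _ _ set0 h') => [|v S S' hSS'].
  apply: eq_bigr => v _; apply: eq_bigl => S.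
  by apply: eq_forallb => i; rewrite h'E.
have SS i : vx i = nth (0, 0) V v -> S i = S' i.
  by move=> /eqP; rewrite -h'E => /eqP; apply: hSS'.
rewrite /F /half_ok.
have -> : half_word h ks S (nth (0, 0) V v) = half_word h ks S' (nth (0, 0) V v).
  congr flatten; apply/eq_in_map => i; rewrite mem_incident => /eqP /SS -> //.
have -> : [forall i, (vx i == nth (0, 0) V v) ==> (#|S i| == me i)] =
          [forall i, (vx i == nth (0, 0) V v) ==> (#|S' i| == me i)].
  by apply: eq_forallb => i; case: eqP => // /SS ->.
by case: ifP => // _; congr (_ * _); apply: eq_bigr => i /eqP /SS ->.
Qed.

Let prod_eta (eta : R) :
  eta ^+ size V * \prod_(p <- V) vertex_sum p = \prod_(p <- V) (eta * vertex_sum p).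
Proof. by rewrite big_split /= big_const_seq count_predT iter_mulr_1. Qed.

Lemma prod_vertex_sum_ge0 (eta : R) :
  (forall i, 0 <= eta * y i) ->
  (forall i j, (rk i < rk j)%N -> 0 <= eta * cross (x i) (x j)) ->
  0 <= eta ^+ size V * \prod_(p <- V) vertex_sum p.
Proof.
move=> hy hx; rewrite prod_eta big_seq prodr_ge0 // => p hp.
by have [[i _ ->]|[i [j [_ _ ij ->]]]] := vertex_sum_cases hp; auto.
Qed.

Lemma prod_vertex_sum_gt0 (eta : R) :
  (forall i, 0 < eta * y i) ->
  (forall i j, (rk i < rk j)%N -> 0 < eta * cross (x i) (x j)) ->
  0 < eta ^+ size V * \prod_(p <- V) vertex_sum p.
Proof.
move=> hy hx; rewrite prod_eta big_seq prodr_gt0 // => p hp.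
by have [[i _ ->]|[i [j [_ _ ij ->]]]] := vertex_sum_cases hp; auto.
Qed.

End HalfEdges.

(** * The trace as a sum over choices of rank-one terms, and its positivity *)

Lemma minor0 (R : numFieldType) (M : 'M[R]_2) T S : minor M T S 0 = 1.
Proof. exact: det_mx00. Qed.

(** For [k = 1] this is the rank-one decomposition of an entry; for [k = 0] or [k = 2] only
    [r = false] remains. The determinant of a double edge is split as [eta * \det M] on the white
    side and [eta] on the black side, so that double edges also bring one factor [eta] to each of
    their endpoints. *)
Lemma minor_half_weight (R : realType) (M : 'M[R]_2) (q p : bool -> 'I_2 -> R)
    (eta : R) k (S T : {set 'I_2}) :
  (k <= 2)%N -> eta * eta = 1 ->
  (forall t s, M t s = \sum_r p r t * q r s) -> #|S| = k -> #|T| = k ->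
  minor M T S k = \sum_(r | (k == 1%N) || ~~ r)
    half_weight k (p r) (eta * \det M) T * half_weight k (q r) eta S.
Proof.
move=> k2 he hM hS hT.
have pr1 (F : bool -> R) : \sum_(r | ~~ r) F r = F false.
  by rewrite (big_pred1 false) // => -[].
case: k k2 hS hT => [|[|[|//]]] _ hS hT.
- by rewrite minor0 pr1 /half_weight /= mulr1.
- have /cards1P [s ->] : #|S| == 1%N by rewrite hS.
  have /cards1P [t ->] : #|T| == 1%N by rewrite hT.
  rewrite /minor det_mx11 mxE !sorted_colors1 /= hM.
  by apply: eq_bigr => r _; rewrite /half_weight /= !big_set1.
have full (X : {set 'I_2}) : #|X| = 2%N -> X = setT.
  by move=> hX; apply/eqP; rewrite eqEcard subsetT cardsT card_ord hX.
rewrite (full S) // (full T) // pr1 /half_weight /= mulrAC he mul1r.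
rewrite /minor; congr (\det _); apply/matrixP; rewrite !sorted_colorsT.
by elim/ord2P; elim/ord2P; rewrite mxE.
Qed.

Lemma hblack_inj e e' : hblack e = hblack e' -> e.2 = e'.2 -> e = e'.
Proof. by case: e e' => [b k] [b' k'] /= -> ->. Qed.

Lemma hwhite_inj e e' : hwhite e = hwhite e' -> e.2 = e'.2 -> e = e'.
Proof.
case: e e' => [[x y] k] [[x' y'] k'] /= h kk; move: h; rewrite /hwhite /= kk.
by move=> [/addIr -> /addIr ->].
Qed.

(* Only edges of multiplicity 1 are expanded into two terms. *)
Definition edge_state (E : seq hedge) (m : hedge -> nat) (i : 'I_(size E)) : pred bool :=
  fun r => (m (eE E i) == 1%N) || ~~ r.

(** A coloring is a pair of independent assignments to the black and the white half-edges. Once a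
    term [r] is fixed on every edge, the summand is a black factor times a white one, and each of
    the two sums factors over its vertices. *)
Lemma trace2_edge_frames (R : realType) (A B : 'M[R]_2) eta q p Bs Ws E m :
  edge_frames A B eta q p -> honeycomb_subgraph Bs Ws E -> is_2multiweb Bs Ws E m ->
  trace2 A B Bs Ws E m =
  \sum_(r : {ffun 'I_(size E) -> bool} | r \in family (edge_state m))
    (\prod_(v <- Bs) vertex_sum hblack [:: 0; 1; 2]%N m
        (fun i => q (eE E i).2 (r i)) (fun=> eta) v) *
    (\prod_(v <- Ws) vertex_sum hwhite [:: 0; 2; 1]%N m
        (fun i => p (eE E i).2 (r i))
        (fun i => eta * \det (hconn A B (eE E i))) v).
Proof.
move=> [he _ _ hM] /and4P [uB uW uE /allP hE] [sB sW].
have hEB e : e \in E -> hblack e \in Bs by move=> /hE /andP [].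
have hEW e : e \in E -> hwhite e \in Ws by move=> /hE /andP [].
have m2 e : e \in E -> (m e <= 2)%N.
  by move=> eE; rewrite -(sB _ (hEB _ eE)) (big_rem e) //= eqxx leq_addr.
pose mk (ST : {ffun 'I_(size E) -> {set 'I_2}} * {ffun 'I_(size E) -> {set 'I_2}})
  : coloring E := [ffun i => (ST.1 i, ST.2 i)].
pose km (c : coloring E) := ([ffun i => (c i).1] : {ffun 'I_(size E) -> {set 'I_2}},
   [ffun i => (c i).2] : {ffun 'I_(size E) -> {set 'I_2}}).
have kmK : cancel km mk by move=> c; apply/ffunP=> i; rewrite !ffunE; case: (c i).
have mkK : cancel mk km.
  by move=> [S T]; congr pair; apply/ffunP=> i; rewrite !ffunE.
have bw ST v : black_word E (mk ST) v = half_word hblack [:: 0; 1; 2]%N ST.1 v.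
  by congr flatten; apply: eq_map => i; rewrite ffunE.
have ww ST v : white_word E (mk ST) v = half_word hwhite [:: 0; 2; 1]%N ST.2 v.
  by congr flatten; apply: eq_map => i; rewrite ffunE.
pose okB (S : {ffun 'I_(size E) -> {set 'I_2}}) := [forall i, #|S i| == m (eE E i)] &&
  all (fun v => perm_eq (half_word hblack [:: 0; 1; 2]%N S v) (enum 'I_2)) Bs.
pose okW (S : {ffun 'I_(size E) -> {set 'I_2}}) := [forall i, #|S i| == m (eE E i)] &&
  all (fun v => perm_eq (half_word hwhite [:: 0; 2; 1]%N S v) (enum 'I_2)) Ws.
pose WB (r : {ffun 'I_(size E) -> bool}) (i : 'I_(size E)) :=
  half_weight (m (eE E i)) (q (eE E i).2 (r i)) eta.
pose WW (r : {ffun 'I_(size E) -> bool}) (i : 'I_(size E)) :=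
  half_weight (m (eE E i)) (p (eE E i).2 (r i)) (eta * \det (hconn A B (eE E i))).
rewrite /trace2 (reindex_onto mk km) => [|c _]; last exact: kmK.
transitivity (\sum_(ST | okB ST.1 && okW ST.2)
    \sum_(r : {ffun 'I_(size E) -> bool} | r \in family (edge_state m))
      ((\prod_(v <- Bs) seq_sign R (half_word hblack [:: 0; 1; 2]%N ST.1 v)) *
         \prod_i WB r i (ST.1 i)) *
      ((\prod_(v <- Ws) seq_sign R (half_word hwhite [:: 0; 2; 1]%N ST.2 v)) *
         \prod_i WW r i (ST.2 i))).
  apply: eq_big => [ST|ST].
    rewrite mkK eqxx andbT /valid_coloring /okB /okW.
    rewrite (eq_all (fun v => congr1 (perm_eq^~ _) (bw ST v))).
    rewrite (eq_all (fun v => congr1 (perm_eq^~ _) (ww ST v))).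
    rewrite andbACA; congr (_ && _); apply/forallP/andP => [hc|[/forallP h1 /forallP h2] i].
      by split; apply/forallP => i; have := hc i; rewrite ffunE => /andP [].
    by rewrite ffunE h1 h2.
  rewrite mkK eqxx andbT => /and3P [/forallP hc _ _].
  under eq_bigr do rewrite bw.
  under [X in _ * X * _]eq_bigr do rewrite ww.
  (* Edges of multiplicity 0 may be included, an empty minor being 1; the product of sums then
     expands into a sum over choice functions [r]. *)
  have -> : \prod_(i < size E | (0 < m (eE E i))%N)
        minor (hconn A B (eE E i)) (mk ST i).2 (mk ST i).1 (m (eE E i)) =
      \prod_i \sum_(r | edge_state m i r)
        half_weight (m (eE E i)) (p (eE E i).2 r) (eta * \det (hconn A B (eE E i)))
          (ST.2 i) * half_weight (m (eE E i)) (q (eE E i).2 r) eta (ST.1 i).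
    rewrite big_mkcond; apply: eq_bigr => i _.
    have := hc i; rewrite ffunE /= => /andP [/eqP cS /eqP cT].
    rewrite -(minor_half_weight _ he _ cS cT) //; last by rewrite m2 ?mem_nth.
    by case: posnP => // ->; rewrite minor0.
  rewrite bigA_distr_big_dep mulr_sumr; apply: eq_bigr => r _.
  rewrite big_split /= /WB /WW; ring.
rewrite exchange_big; apply: eq_bigr => r _ /=.
rewrite -(sum_half_colorings m _ uB hEB) //.
rewrite -(sum_half_colorings m _ uW hEW) //.
by rewrite big_distrlr /= pair_big.
Qed.

(** Equal numbers of black and white vertices allow one factor [eta] to be attached to every vertex
    at no cost. All vertex factors are then nonnegative, and they are positive for the choice [r0]
    of [false] everywhere. *)
Lemma trace2_gt0_edge_frames (R : realType) (A B : 'M[R]_2) eta q p Bs Ws E m :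
  edge_frames A B eta q p -> 0 < \det A -> 0 < \det B ->
  honeycomb_subgraph Bs Ws E -> size Bs = size Ws -> is_2multiweb Bs Ws E m ->
  0 < trace2 A B Bs Ws E m.
Proof.
move=> hf dA dB hg hsz hm; rewrite (trace2_edge_frames hf hg hm).
have [he hq hp _] := hf; have [uB uW uE /allP hE] := and4P hg; have [sB sW] := hm.
have hEB e : e \in E -> hblack e \in Bs by move=> /hE /andP [].
have hEW e : e \in E -> hwhite e \in Ws by move=> /hE /andP [].
have dM e : 0 < \det (hconn A B e).
  by rewrite /hconn; do 2?case: ifP => _ //; rewrite det1.
have eta1 : eta ^+ size Bs * eta ^+ size Ws = 1 by rewrite hsz -exprMn he expr1n.
pose r0 : {ffun 'I_(size E) -> bool} := [ffun=> false].
rewrite (bigD1 r0) /=; last by apply/familyP=> i; rewrite /in_mem /= /edge_state ffunE orbT.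
have split2 (a b : R) : a * b = (eta ^+ size Bs * a) * (eta ^+ size Ws * b).
  by rewrite mulrACA eta1 mul1r.
apply: ltr_pwDl.
  rewrite split2 mulr_gt0 //.
    apply: (prod_vertex_sum_gt0 hblack_inj) => // [i|i j ij]; first by rewrite he.
    by rewrite !ffunE; apply: (hq _ _ ij).2.
  apply: (prod_vertex_sum_gt0 hwhite_inj) => // [i|i j ij].
    by rewrite mulrA he mul1r.
  by rewrite !ffunE; apply: (hp _ _ ij).2.
apply: sumr_ge0 => r _; rewrite split2 mulr_ge0 //.
  apply: (prod_vertex_sum_ge0 hblack_inj) => // [i|i j ij]; first by rewrite he.
  by apply: (hq _ _ ij).1.
apply: (prod_vertex_sum_ge0 hwhite_inj) => // [i|i j ij].
  by rewrite mulrA he mul1r ltW.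
by apply: (hp _ _ ij).1.
Qed.

(** * Invariance of the trace under negation of [A] or [B] *)

Lemma minorZ (R : numFieldType) (s : R) (M : 'M[R]_2) T S k :
  minor (s *: M) T S k = s ^+ k * minor M T S k.
Proof.
by rewrite /minor -detZ; congr (\det _); apply/matrixP=> i j; rewrite !mxE.
Qed.

Lemma trace2Z (R : numFieldType) (s1 s2 : R) (A B : 'M[R]_2) Bs Ws E m :
  trace2 (s1 *: A) (s2 *: B) Bs Ws E m =
  s1 ^+ (\sum_(e <- E | val e.2 == 1%N) m e) *
  s2 ^+ (\sum_(e <- E | val e.2 == 2%N) m e) * trace2 A B Bs Ws E m.
Proof.
rewrite /trace2 mulr_sumr; apply: eq_bigr => c _.
rewrite !expr_sum !(big_mkcond (fun e : hedge => _ == _)) -big_split.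
rewrite (big_nth he0) big_mkord mulrCA; congr (_ * _).
rewrite !(big_mkcond (fun i : 'I_(size E) => (0 < _)%N)) -big_split.
apply: eq_bigr => i _ /=; case: posnP => [|_].
  by rewrite /eE => ->; rewrite !expr0 !if_same !mulr1.
rewrite /hconn /eE; case: (nth he0 E i).2 => [[|[|[|//]]] ?] /=.
- by rewrite !mul1r.
- by rewrite minorZ mulr1.
- by rewrite minorZ mul1r.
Qed.

(** Double counting: grouping the edges by endpoint, each vertex collects total multiplicity 2. *)
Lemma sum_by_vertex (h : hedge -> int * int) (V : seq (int * int)) (E : seq hedge)
    (m : hedge -> nat) (c : int * int -> int) :
  uniq V -> (forall e, e \in E -> h e \in V) ->
  (forall p, p \in V -> (\sum_(e <- E | h e == p) m e)%N = 2%N) ->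
  \sum_(e <- E) c (h e) * (m e)%:Z = 2 * \sum_(p <- V) c p.
Proof.
move=> uV hE hV.
transitivity (\sum_(p <- V) \sum_(e <- E | h e == p) c p * (m e)%:Z).
  rewrite (exchange_big_dep xpredT) //= big_seq [RHS]big_seq.
  apply: eq_bigr => e /hE he; rewrite -big_filter.
  have -> : [seq p <- V | h e == p] = [:: h e].
    by rewrite -(filter_pred1_uniq uV he); apply: eq_filter => p; rewrite /= eq_sym.
  by rewrite big_cons big_nil addr0.
rewrite mulr_sumr big_seq [RHS]big_seq; apply: eq_bigr => p hp.
rewrite -mulr_sumr mulrC; congr (_ * _).
by rewrite -[2]/(2%N%:Z) -(hV p hp) -!natz natr_sum; apply: eq_bigr => e _; rewrite natz.
Qed.

Lemma even_edge_type (Bs Ws : seq (int * int)) (E : seq hedge) (m : hedge -> nat) k :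
  honeycomb_subgraph Bs Ws E -> is_2multiweb Bs Ws E m -> (0 < k < 3)%N ->
  ~~ odd (\sum_(e <- E | val e.2 == k) m e).
Proof.
move=> /and4P [uB uW uE /allP hE] [sB sW] hk.
(* From the black to the white endpoint this coordinate grows by 1 along edges of type [k] and is
   constant along the others. *)
pose c (p : int * int) := if k == 1%N then p.1 else p.2.
have hB := sum_by_vertex c uB (fun e he => proj1 (andP (hE e he))) sB.
have hW := sum_by_vertex c uW (fun e he => proj2 (andP (hE e he))) sW.
have hN : (\sum_(e <- E | val e.2 == k) m e)%N%:Z =
    2 * (\sum_(p <- Ws) c p - \sum_(p <- Bs) c p).
  rewrite mulrBr -hW -hB -sumrB -natz natr_sum big_mkcond /=.
  apply: eq_bigr => e _; rewrite natz -mulrBl /c /hwhite /hblack.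
  case: k hk {c hB hW} => [|[|[|//]]] // _; case: e => [[a b] [[|[|[|//]]] ?]] /=;
  by rewrite /hshift /=; ring.
rewrite -dvdn2 -[(_ %| _)%N]/((2%N%:Z %| _%N%:Z)%Z) hN; apply: dvdz_mulr; exact: dvdzz.
Qed.

Section Opposite.
Variables (R : realType) (A B : 'M[R]_2) (Bs Ws : seq (int * int)).
Variables (E : seq hedge) (m : hedge -> nat).
Hypotheses (hg : honeycomb_subgraph Bs Ws E) (hm : is_2multiweb Bs Ws E m).

Lemma trace2_oppl : trace2 (- A) B Bs Ws E m = trace2 A B Bs Ws E m.
Proof.
rewrite -[- A]scaleN1r -{1}[B]scale1r trace2Z expr1n mulr1 -signr_odd.
by rewrite (negPf (even_edge_type hg hm _)) // mul1r.
Qed.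

Lemma trace2_oppr : trace2 A (- B) Bs Ws E m = trace2 A B Bs Ws E m.
Proof.
rewrite -[- B]scaleN1r -{1}[A]scale1r trace2Z expr1n mul1r -signr_odd.
by rewrite (negPf (even_edge_type hg hm _)) // mul1r.
Qed.
End Opposite.

(** * Eigenvalue signs under negation, and reduction to a single sign pattern *)

Lemma char_poly2N (R : comNzRingType) (M : 'M[R]_2) l1 l2 :
  char_poly M = ('X - l1%:P) * ('X - l2%:P) ->
  char_poly (- M) = ('X - (- l1)%:P) * ('X - (- l2)%:P).
Proof.
rewrite /char_poly !det_mx2 !mxE /= !mulr1n !mulr0n !sub0r.
(* In dimension 2 the characteristic polynomial of [- M] is that of [M] with [- 'X] substituted for
   ['X]. *)
move=> /(congr1 (fun p => p \Po (- 'X))).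
rewrite !(comp_polyM, comp_polyB, comp_polyX, comp_polyC, rmorphN) /= => h.
transitivity ((- 'X - l1%:P) * (- 'X - l2%:P)); last by ring.
by rewrite -h ?comp_polyC; ring.
Qed.

Lemma eig_posN (R : realType) (M : 'M[R]_2) : eig_pos M -> eig_neg (- M).
Proof.
move=> [l1 [l2 [h1 h2 /char_poly2N hM]]]; exists (- l1), (- l2).
by rewrite !oppr_lt0.
Qed.

Lemma eig_negN (R : realType) (M : 'M[R]_2) : eig_neg M -> eig_pos (- M).
Proof.
move=> [l1 [l2 [h1 h2 /char_poly2N hM]]]; exists (- l1), (- l2).
by rewrite !oppr_gt0.
Qed.

Lemma trace2_gt0 (R : realType) (A B : 'M[R]_2) Bs Ws E m :
  B \in unitmx -> eig_pos A -> eig_pos B -> eig_neg (A *m invmx B) ->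
  honeycomb_subgraph Bs Ws E -> size Bs = size Ws -> is_2multiweb Bs Ws E m ->
  0 < trace2 A B Bs Ws E m.
Proof.
move=> uB hA hB hC; have [eta [q [p hf]]] := exists_edge_frames uB hA hB hC.
have [dA _] := eig_pos_spec hA; have [dB _] := eig_pos_spec hB.
exact: trace2_gt0_edge_frames hf dA dB.
Qed.

Lemma unitmxN (R : comUnitRingType) n (M : 'M[R]_n) : (- M \in unitmx) = (M \in unitmx).
Proof. by rewrite -scaleN1r unitmxZ // unitrN1. Qed.

Lemma invmxN (R : comUnitRingType) n (M : 'M[R]_n) : M \in unitmx -> invmx (- M) = - invmx M.
Proof. by move=> uM; rewrite -scaleN1r invmxZ ?unitmxZ ?unitrN1 // invrN1 scaleN1r. Qed.

Theorem theorem6 (R : realType) (A B : 'M[R]_2) :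
  A \in unitmx -> B \in unitmx -> sign_condition A B ->
  forall (Bs Ws : seq (int * int)) (E : seq hedge),
    honeycomb_subgraph Bs Ws E -> size Bs = size Ws ->
  forall m : hedge -> nat, is_2multiweb Bs Ws E m ->
    0 < trace2 A B Bs Ws E m.
Proof.
move=> uA uB hsign Bs Ws E hg hsz m hm.
have uNB : - B \in unitmx by rewrite unitmxN.
(* The first case is the normalized one; negating [B], [A], or both brings the other three to it,
   since [A *m invmx B] changes sign with each negation. *)
case: hsign => -[hA hB hC].
- exact: trace2_gt0 hg hsz hm.
- rewrite -(trace2_oppr _ _ hg hm); apply: trace2_gt0 hg hsz hm => //.
    exact: eig_negN.
  by rewrite invmxN // mulmxN; apply: eig_posN.
- rewrite -(trace2_oppl _ _ hg hm); apply: trace2_gt0 hg hsz hm => //.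
    exact: eig_negN.
  by rewrite mulNmx; apply: eig_posN.
- rewrite -(trace2_oppl _ _ hg hm) -(trace2_oppr _ _ hg hm).
  apply: trace2_gt0 hg hsz hm => //; [exact: eig_negN | exact: eig_negN |].
  by rewrite invmxN // mulmxN mulNmx opprK.
Qed.
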